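(* Let $C$ be a field of characteristic $3$ equipped with an absolute value, let $f(t) = t^3 + c_1 t^2 + c_2 t + c_3 \in C[t]$ with $c_1 \ne 0$, and let $\Delta = c_1^2 c_2^2 - c_1^3 c_3 - c_2^3$ be the discriminant of $f$. If the series $\mathcal{B}_{3,-1}(\Delta/c_1^6)$ converges to $\lambda \in C$, then $$f(\alpha) = 0 \quad \text{for} \quad \alpha = \frac{c_2}{c_1} - c_1\lambda \in C.$$
   Context: An absolute value on a field $C$ is a map $|\cdot|\colon C \to \mathbb{R}_{\ge 0}$ with $|x| = 0$ iff $x = 0$, $|xy| = |x||y|$, and $|x+y| \le |x|+|y|$; $C$ is not assumed complete. The power series $\mathcal{B}_{3,-1}(z) \in \mathbb{Z}[[z]]$ is $$\mathcal{B}_{3,-1}(z) := \sum_{m \ge 0} \frac{-1}{3m-1}\binom{3m-1}{m} z^m,$$ whose coefficients are integers and whose constant term is $1$. For $x \in C$, the series $\mathcal{B}_{3,-1}(x)$ is obtained by substituting $z = x$, with integer coefficients interpreted in $C$ via $\mathbb{Z}\to C$. *)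

(* Defs.v *)
From mathcomp Require Import all_boot all_order all_algebra.
From mathcomp Require Import ring.
From mathcomp Require Import all_classical all_reals all_analysis.

Set Implicit Arguments.
Unset Strict Implicit.
Unset Printing Implicit Defensive.

Import Order.TTheory GRing.Theory Num.Theory.
Import numFieldNormedType.Exports.

Local Open Scope ring_scope.
Local Open Scope classical_set_scope.

Definition is_absolute_value (R : realType) (C : fieldType) (v : C -> R) :=
  [/\ forall x, 0 <= v x,
      forall x, v x = 0 <-> x = 0,
      forall x y, v (x * y) = v x * v y
    & forall x y, v (x + y) <= v x + v y].

(* The upper argument is rational because m = 0 below calls for binom(-1, 0). *)
Definition gbinom (a : rat) (m : nat) : rat :=
  (\prod_(i < m) (a - i%:R)) / m`!%:R.

Definition B3m1_rat (m : nat) : rat :=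
  -1 / (3 * m%:R - 1) * gbinom (3 * m%:R - 1) m.

(* Taking the numerator loses nothing: these rationals are integers, see
   B3m1E. *)
Definition B3m1 (m : nat) : int := numq (B3m1_rat m).

Definition psum (C : fieldType) (a : nat -> int) (x : C) (n : nat) : C :=
  \sum_(0 <= m < n) (a m)%:~R * x ^+ m.

Definition pseries_cvg_to (R : realType) (C : fieldType) (v : C -> R)
    (a : nat -> int) (x l : C) : Prop :=
  v (psum a x n - l) @[n --> \oo] --> (0 : R).

Lemma gbinom_nat (n m : nat) : gbinom n%:R m = 'C(n, m)%:R.
Proof.
have E : \prod_(i < m) (n%:R - i%:R : rat) = (n ^_ m)%:R.
  elim: m => [|m IH]; first by rewrite big_ord0 ffactn0.
  rewrite big_ord_recr /= IH ffactnSr natrM.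
  have [le_mn|lt_nm] := leqP m n; first by rewrite natrB.
  by rewrite ffact_small // !mul0r.
by rewrite /gbinom E -bin_ffact natrM mulfK // pnatr_eq0 -lt0n fact_gt0.
Qed.

Lemma B3m1_rat_int (m : nat) : exists z : int, B3m1_rat m = z%:~R.
Proof.
case: m => [|m].
  by exists 1; rewrite /B3m1_rat /gbinom big_ord0 fact0 mulr0 sub0r divff ?mul1r ?divff.
have En : 3 * m.+1%:R - 1 = (3 * m + 2)%:R :> rat.
  by rewrite natrD natrM -natr1; ring.
have dvd : (3 * m + 2 %| 'C(3 * m + 2, m.+1))%N.
  have co : coprime (3 * m + 2) m.+1.
    rewrite /coprime -dvdn1.
    have d1 := dvdn_gcdl (3 * m + 2) m.+1; have d2 := dvdn_gcdr (3 * m + 2) m.+1.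
    have : (gcdn (3 * m + 2) m.+1 %| 3 * m + 2 + 1)%N.
      have -> : (3 * m + 2 + 1 = 3 * m.+1)%N by rewrite mulnS -addnA addnC.
      exact: dvdn_mull.
    by rewrite dvdn_addr.
  rewrite -(Gauss_dvdr _ co).
  have -> : (3 * m + 2 = (3 * m + 1).+1)%N by rewrite addnS.
  by rewrite -mul_bin_diag dvdn_mulr.
have /dvdnP[q Eq] := dvd.
exists (- q%:Z); rewrite /B3m1_rat En gbinom_nat Eq natrM rmorphN /=.
have nz : (3 * m + 2)%:R != 0 :> rat by rewrite pnatr_eq0 addn2.
by rewrite mulN1r mulNr mulrCA mulVf // mulr1.
Qed.

Lemma B3m1E (m : nat) : (B3m1 m)%:~R = B3m1_rat m.
Proof. by have [z Ez] := B3m1_rat_int m; rewrite /B3m1 Ez numq_int. Qed.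

(* Main.v *)
Require Import Defs.
From mathcomp Require Import all_boot all_order all_algebra.
From mathcomp Require Import ring lra zify.
From mathcomp Require Import all_classical all_reals all_analysis.

Set Implicit Arguments.
Unset Strict Implicit.
Unset Printing Implicit Defensive.

Import Order.TTheory GRing.Theory Num.Theory.
Import numFieldNormedType.Exports.

Local Open Scope ring_scope.

(** Write [S] for the series, with partial sums [S_n], and [x] for the point
    where it converges to [l].  Substituting [alpha] into [f] reduces the
    theorem to the cubic equation [l^3 - l^2 + x = 0] ([B3m1_cvg_cubic]).  As
    power series over the integers [S] is [1 / B] with [B = 1 + z B^3], which
    gives this cubic formally; but [S(x)] is only a limit and [C] need not be
    complete, so the equation is derived from the partial sums.

    Modulo 3 the coefficients of [S] and [B] are [C(3m - 1, m)] and
    [C(3m + 1, m)].  Lucas' theorem splits them by the residue of [m] modulo 3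
    and the Frobenius map turns the result into exact identities between the
    partial sums [S_n] and [T_n] of the two series:
    [S_3n = 2 x + S_n^3 + x^2 T_n^3] and [T_3n = 1 + x T_n^3]
    ([psum_B3m1_mul3], [psum_bin3_mul3]).  Eliminating [T] and passing to the
    limit yields an equation of degree 9 for [l] ([B3m1_cvg_elim]), which is the
    product of the cubic at [l], [l + 1] and [l - 1] ([B3m1_elim_factor]).

    It remains to discard the last two factors.  In characteristic 3 every
    absolute value is ultrametric ([absval_ultrametric]); convergence forces
    [v x < 1], because infinitely many coefficients are units
    ([B3m1_cvg_lt1]), and then [v (l - 1) <= v x] ([B3m1_cvg_sub1_le]), which
    places [l] near the simple root 1 of the reduced cubic [l^3 - l^2]. *)

(** * Binomial coefficients in prime characteristic *)

(** Compare coefficients in [(1 + X)^(n + p) = (1 + X)^n (1 + X^p)]. *)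
Lemma bin_addp_pchar (R : comNzRingType) (p : nat) (hp : p \in [pchar R])
    (n k : nat) :
  'C(n + p, k)%:R =
    'C(n, k)%:R + (if (k < p)%N then 0 else 'C(n, k - p)%:R) :> R.
Proof.
have coef1X m j : ((1 + 'X) ^+ m : {poly R})`_j = 'C(m, j)%:R.
  rewrite exprDn coef_sum.
  under eq_bigr => i _ do rewrite expr1n mul1r coefMn coefXn.
  have [ltjm|] := ltnP j m.+1.
    rewrite (bigD1 (Ordinal ltjm)) //= eqxx big1 ?addr0 // => i ne_ij.
    by rewrite eq_sym -val_eqE /= in ne_ij; rewrite (negPf ne_ij) mul0rn.
  move=> ltmj; rewrite bin_small // big1 // => i _.
  by rewrite gtn_eqF ?mul0rn // (leq_trans (ltn_ord i)).
have hpX : p \in [pchar {poly R}] by rewrite pchar_poly.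
have FrobX : (1 + 'X) ^+ p = 1 + 'X^p :> {poly R}.
  by rewrite -!(pFrobenius_autE hpX) rmorphD rmorph1.
by rewrite -!coef1X exprD FrobX mulrDr mulr1 coefD coefMXn.
Qed.

(** Lucas' theorem, splitting off the lowest base-p digit: by the previous
    lemma, raising the upper index by [p] obeys Pascal's rule in the leading
    digits, whence an induction on [a]. *)
Lemma bin_lucas (R : comNzRingType) (p : nat) (hp : p \in [pchar R])
    (a i q r : nat) (hi : (i < p)%N) (hr : (r < p)%N) :
  'C(p * a + i, p * q + r)%:R = 'C(a, q)%:R * 'C(i, r)%:R :> R.
Proof.
elim: a q => [|a IHa] q.
  case: q => [|q]; first by rewrite muln0 !add0n bin0 mul1r.
  by rewrite muln0 add0n bin0n mul0r bin_small // mulnS; lia.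
have -> : (p * a.+1 + i = p * a + i + p)%N by rewrite mulnS; lia.
rewrite bin_addp_pchar //; case: q => [|q].
  by rewrite IHa muln0 add0n hr addr0 !bin0.
rewrite ifN; last by rewrite -leqNgt mulnS; lia.
have -> : (p * q.+1 + r - p = p * q + r)%N by rewrite mulnS; lia.
by rewrite !IHa binS natrD mulrDl.
Qed.

(** * The coefficients modulo 3 *)

Lemma nat3_eq0 (C : fieldType) (hchar : 3%N \in [pchar C]) : 3 = 0 :> C.
Proof. exact: pcharf0 hchar. Qed.

Lemma B3m1_0 : B3m1 0 = 1.
Proof.
apply: (@intr_inj rat); rewrite B3m1E /B3m1_rat /gbinom big_ord0 fact0.
by rewrite mulr0 sub0r divff ?mul1r ?divff.
Qed.

(** The prefactor [-1 / (3m - 1)] is congruent to 1 modulo 3. *)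
Lemma B3m1_pchar3 (C : fieldType) (hchar : 3%N \in [pchar C]) (m : nat) :
  (B3m1 m.+1)%:~R = 'C(3 * m + 2, m.+1)%:R :> C.
Proof.
have En : 3 * m.+1%:R - 1 = (3 * m + 2)%:R :> rat.
  by rewrite natrD natrM -natr1; ring.
have nz : (3 * m + 2)%:R != 0 :> rat by rewrite pnatr_eq0 addn2.
have E : (3 * m + 2)%:Z * B3m1 m.+1 = - 'C(3 * m + 2, m.+1)%:Z.
  apply: (@intr_inj rat).
  by rewrite rmorphM rmorphN /= B3m1E /B3m1_rat En gbinom_nat; field.
have := congr1 (fun z : int => z%:~R : C) E.
rewrite rmorphM rmorphN /= -!pmulrn natrD natrM (nat3_eq0 hchar) mul0r add0r.
move=> {}E; apply/eqP; rewrite -subr_eq0 -[X in _ - X]opprK -E; apply/eqP.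
have -> : (B3m1 m.+1)%:~R - - (2 * (B3m1 m.+1)%:~R)
          = 3 * (B3m1 m.+1)%:~R :> C by ring.
by rewrite (nat3_eq0 hchar) mul0r.
Qed.

Lemma bin_mul3_pchar3 (C : fieldType) (hchar : 3%N \in [pchar C]) (q : nat) :
  'C(3 * q.+1, q.+1)%:R = 0 :> C.
Proof.
have E : ('C(3 * q.+1, q.+1) = 3 * 'C(3 * q + 2, q))%N.
  apply/eqP; rewrite -(eqn_pmul2l (ltn0Sn q)).
  have -> : (3 * q.+1 = (3 * q + 2).+1)%N by lia.
  by rewrite -mul_bin_diag mulnA; apply/eqP; congr (_ * _)%N; lia.
by rewrite E natrM (nat3_eq0 hchar) mul0r.
Qed.

Lemma B3m1_mod3_0 (C : fieldType) (hchar : 3%N \in [pchar C]) (q : nat) :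
  (B3m1 (3 * q))%:~R = (B3m1 q)%:~R :> C.
Proof.
case: q => [|q]; first by rewrite muln0.
have -> : (3 * q.+1 = (3 * q + 2).+1)%N by lia.
rewrite !B3m1_pchar3 //.
have -> : ((3 * q + 2).+1 = 3 * q.+1 + 0)%N by lia.
by rewrite bin_lucas // bin0 mulr1.
Qed.

Lemma B3m1_mod3_1 (C : fieldType) (hchar : 3%N \in [pchar C]) (q : nat) :
  (B3m1 (3 * q + 1))%:~R = if q == 0%N then 2 else 0 :> C.
Proof.
rewrite addn1 B3m1_pchar3 // -[(3 * q).+1]addn1 bin_lucas //.
case: q => [|q]; first by rewrite muln0 !bin0 bin1 mul1r.
by rewrite bin_mul3_pchar3 // mul0r.
Qed.

(** Modulo 3 these are the coefficients [C(3m + 1, m) / (3m + 1)] of the series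
    [B] with [B = 1 + z B^3], the inverse of the series with coefficients
    [B3m1]. *)
Definition bin3 (m : nat) : int := 'C(3 * m + 1, m).

Lemma B3m1_mod3_2 (C : fieldType) (hchar : 3%N \in [pchar C]) (q : nat) :
  (B3m1 (3 * q + 2))%:~R = (bin3 q)%:~R :> C.
Proof.
rewrite addn2 B3m1_pchar3 // -[(3 * q).+2]addn2 bin_lucas // binn mulr1.
by rewrite /bin3 -pmulrn addn1.
Qed.

Lemma bin3_mod3_0 (C : fieldType) (hchar : 3%N \in [pchar C]) (q : nat) :
  (bin3 (3 * q))%:~R = if q == 0%N then 1 else 0 :> C.
Proof.
rewrite /bin3 -pmulrn -[X in 'C(_, X)]addn0 bin_lucas // bin0 mulr1.
by case: q => [|q]; [rewrite muln0 bin0 | rewrite bin_mul3_pchar3].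
Qed.

Lemma bin3_mod3_1 (C : fieldType) (hchar : 3%N \in [pchar C]) (q : nat) :
  (bin3 (3 * q + 1))%:~R = (bin3 q)%:~R :> C.
Proof. by rewrite /bin3 -!pmulrn bin_lucas // binn mulr1. Qed.

Lemma bin3_mod3_2 (C : fieldType) (hchar : 3%N \in [pchar C]) (q : nat) :
  (bin3 (3 * q + 2))%:~R = 0 :> C.
Proof.
by rewrite /bin3 -pmulrn bin_lucas // [X in _ * X%:R]bin_small // mulr0.
Qed.

(** * Functional equations for partial sums *)

Lemma cube_sub_pchar3 (C : fieldType) (hchar : 3%N \in [pchar C]) (x y : C) :
  (x - y) ^+ 3 = x ^+ 3 - y ^+ 3.
Proof. by rewrite -!(pFrobenius_autE hchar) rmorphB. Qed.

Lemma cube_add_pchar3 (C : fieldType) (hchar : 3%N \in [pchar C]) (x y : C) :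
  (x + y) ^+ 3 = x ^+ 3 + y ^+ 3.
Proof. by rewrite -!(pFrobenius_autE hchar) rmorphD. Qed.

(** Integers are fixed by the Frobenius map, so that cubing a partial sum only
    changes the exponents. *)
Lemma psum_cube_pchar3 (C : fieldType) (hchar : 3%N \in [pchar C])
    (a : nat -> int) (x : C) (n : nat) :
  psum a x n ^+ 3 = \sum_(0 <= q < n) (a q)%:~R * x ^+ (3 * q).
Proof.
rewrite -(pFrobenius_autE hchar) rmorph_sum /=; apply: eq_bigr => q _.
by rewrite rmorphM rmorph_int /= pFrobenius_autE -exprM mulnC.
Qed.

Lemma psum_mul3 (C : fieldType) (a : nat -> int) (x : C) (n : nat) :
  psum a x (3 * n) = \sum_(0 <= q < n)
    ((a (3 * q)%N)%:~R + (a (3 * q + 1)%N)%:~R * x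
      + (a (3 * q + 2)%N)%:~R * x ^+ 2) * x ^+ (3 * q).
Proof.
rewrite /psum; elim: n => [|n IHn]; first by rewrite muln0 !big_geq.
rewrite [RHS]big_nat_recr //= -IHn.
have -> : (3 * n.+1 = (3 * n).+3)%N by lia.
rewrite !big_nat_recr //= -[(3 * n).+2]addn2 -[(3 * n).+1]addn1 !exprD.
by ring.
Qed.

Lemma sum_nat_delta0 (C : fieldType) (c : C) (F : nat -> C) (n : nat)
    (hn : (0 < n)%N) :
  \sum_(0 <= q < n) (if q == 0%N then c else 0) * F q = c * F 0%N.
Proof.
case: n hn => // n _; rewrite big_nat_recl //= big1 ?addr0 // => q _.
by rewrite mul0r.
Qed.

Lemma psum_bin3_mul3 (C : fieldType) (hchar : 3%N \in [pchar C]) (x : C)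
    (n : nat) (hn : (0 < n)%N) :
  psum bin3 x (3 * n) = 1 + x * psum bin3 x n ^+ 3.
Proof.
rewrite psum_mul3 psum_cube_pchar3 // mulr_sumr.
under eq_bigr => q _ do
  rewrite bin3_mod3_0 // bin3_mod3_1 // bin3_mod3_2 // mul0r addr0 mulrDl.
rewrite big_split /= sum_nat_delta0 // muln0 mulr1; congr (_ + _).
by apply: eq_bigr => q _; ring.
Qed.

Lemma psum_B3m1_mul3 (C : fieldType) (hchar : 3%N \in [pchar C]) (x : C)
    (n : nat) (hn : (0 < n)%N) :
  psum B3m1 x (3 * n) =
    2 * x + psum B3m1 x n ^+ 3 + x ^+ 2 * psum bin3 x n ^+ 3.
Proof.
rewrite psum_mul3 !psum_cube_pchar3 // mulr_sumr.
under eq_bigr => q _ do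
  rewrite B3m1_mod3_0 // B3m1_mod3_1 // B3m1_mod3_2 // !mulrDl
    -[_ * x * _]mulrA.
rewrite !big_split /= sum_nat_delta0 // muln0 mulr1 [_ + 2 * x]addrC.
by congr (_ + _); apply: eq_bigr => q _; ring.
Qed.

(** * Absolute values *)

Lemma absval1 (R : realType) (C : fieldType) (v : C -> R)
    (hv : is_absolute_value v) : v 1 = 1.
Proof.
case: hv => _ v0 vM _.
have nz1 : v 1 != 0 by apply/eqP => /v0/eqP; rewrite oner_eq0.
by apply: (mulfI nz1); rewrite -vM !mulr1.
Qed.

Lemma absvalX (R : realType) (C : fieldType) (v : C -> R)
    (hv : is_absolute_value v) (x : C) (n : nat) : v (x ^+ n) = v x ^+ n.
Proof.
elim: n => [|n IHn]; first by rewrite !expr0 absval1.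
by case: hv => _ _ vM _; rewrite !exprS vM IHn.
Qed.

Lemma absvalN (R : realType) (C : fieldType) (v : C -> R)
    (hv : is_absolute_value v) (x : C) : v (- x) = v x.
Proof.
have [v_ge0 _ vM _] := hv.
have vN1 : v (-1) = 1.
  apply/eqP; rewrite -(@eqrXn2 _ 2) ?v_ge0 // expr1n -absvalX //.
  by rewrite sqrrN expr1n absval1.
by rewrite -mulN1r vM vN1 mul1r.
Qed.

(** In characteristic p an absolute value is ultrametric: with [n = p ^ k] and
    [M] the larger of the two values,
    [v (x + y) ^ n = v (x ^ n + y ^ n) <= 2 M ^ n], so that the ratio
    [M / v (x + y)] cannot be smaller than 1. *)
Lemma absval_ultrametric (R : realType) (C : fieldType) (v : C -> R) (p : nat)
    (hp : p \in [pchar C]) (hv : is_absolute_value v) (x y : C) (e : R) :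
  v x <= e -> v y <= e -> v (x + y) <= e.
Proof.
have [v_ge0 _ _ v_tri] := hv.
move=> vx vy; rewrite leNgt; apply/negP => lt_e.
have e_ge0 : 0 <= e by apply: le_trans vx.
have s_gt0 : 0 < v (x + y) by apply: le_lt_trans lt_e.
pose q := e / v (x + y).
have q_ge0 : 0 <= q by rewrite divr_ge0.
have q_lt1 : `|q| < 1 by rewrite ger0_norm // ltr_pdivrMr // mul1r.
have half_gt0 : 0 < 2^-1 :> R by rewrite invr_gt0.
have [N _ small] := cvgr0_norm_lt _ (cvg_expr q_lt1) _ half_gt0.
have p_gt1 : (1 < p)%N := prime_gt1 (pcharf_prime hp).
have /small : (N <= p ^ N)%N by rewrite ltnW // ltn_expl.
apply/negP; rewrite -leNgt ger0_norm ?exprn_ge0 // exprMn exprVn.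
rewrite ler_pdivlMr ?exprn_gt0 // mulrC ler_pdivrMr // -absvalX //.
have pN : [pchar C].-nat (p ^ N)%N.
  by rewrite (eq_pnat _ (pcharf_eq hp)) pnatX pnat_id ?(pcharf_prime hp).
rewrite (exprDn_pchar x y pN) mulrDr mulr1; apply: le_trans (v_tri _ _) _.
by apply: lerD; rewrite absvalX // lerXn2r // nnegrE.
Qed.

Lemma absval_ultrametricB (R : realType) (C : fieldType) (v : C -> R) (p : nat)
    (hp : p \in [pchar C]) (hv : is_absolute_value v) (x y : C) (e : R) :
  v x <= e -> v y <= e -> v (x - y) <= e.
Proof.
by move=> vx vy; apply: (absval_ultrametric hp hv vx); rewrite absvalN.
Qed.

Lemma absval_int_le1 (R : realType) (C : fieldType) (v : C -> R) (p : nat)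
    (hp : p \in [pchar C]) (hv : is_absolute_value v) (z : int) :
  v z%:~R <= 1.
Proof.
have v_nat n : v n%:R <= 1.
  elim: n => [|n IHn]; first by case: hv => _ v0 _ _; rewrite (v0 0).2.
  by rewrite -natr1; apply: (absval_ultrametric hp hv IHn); rewrite absval1.
by case: z => n; rewrite ?NegzE ?rmorphN /= ?absvalN -?pmulrn.
Qed.

Lemma absval_eq0 (R : realType) (C : fieldType) (v : C -> R)
    (hv : is_absolute_value v) (x : C) :
  (forall e, 0 < e -> e <= 1 -> v x <= e) -> x = 0.
Proof.
have [v_ge0 v0 _ _] := hv.
move=> small; apply/v0/eqP; rewrite eq_le v_ge0 andbT leNgt.
apply/negP => vx_gt0.
have := small (Num.min 1 (v x / 2)).
rewrite lt_min ltr01 divr_gt0 // ge_min lexx => /(_ isT isT).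
by rewrite le_min => /andP[_]; lra.
Qed.

Lemma pseries_cvg_to_lt (R : realType) (C : fieldType) (v : C -> R)
    (hv : is_absolute_value v) (a : nat -> int) (x l : C) (e : R) :
  pseries_cvg_to v a x l -> 0 < e ->
  exists N, forall n, (N <= n)%N -> v (psum a x n - l) < e.
Proof.
move=> cvg_l e_gt0; have [N _ small] := cvgr0_norm_lt _ cvg_l e e_gt0.
exists N => n leNn; apply: le_lt_trans (small n leNn).
exact: ler_norm.
Qed.

(** * Size of the sum of the series *)

(** The coefficients of index [3 ^ k] are all equal to 2, a unit: they do not
    tend to 0. *)
Lemma B3m1_cvg_lt1 (R : realType) (C : fieldType) (v : C -> R)
    (hchar : 3%N \in [pchar C]) (hv : is_absolute_value v) (x l : C) :
  pseries_cvg_to v B3m1 x l -> v x < 1.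
Proof.
have [v_ge0 _ vM _] := hv.
move=> cvg_l; have half_gt0 : 0 < 2^-1 :> R by rewrite invr_gt0.
have [N small] := pseries_cvg_to_lt hv cvg_l half_gt0.
have coef2 k : (B3m1 (3 ^ k))%:~R = 2 :> C.
  elim: k => [|k IHk]; first by rewrite (B3m1_mod3_1 hchar 0).
  by rewrite expnS B3m1_mod3_0.
have v2 : v 2 = 1.
  have -> : 2 = 3 - 1 :> C by ring.
  by rewrite (nat3_eq0 hchar) sub0r absvalN // absval1.
rewrite ltNge; apply/negP => x_ge1.
have leN : (N <= 3 ^ N)%N by rewrite ltnW // ltn_expl.
have : v ((psum B3m1 x (3 ^ N).+1 - l) - (psum B3m1 x (3 ^ N) - l)) <= 2^-1.
  by apply: (absval_ultrametricB hchar hv); apply/ltW/small => //; lia.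
have -> : psum B3m1 x (3 ^ N).+1 - l - (psum B3m1 x (3 ^ N) - l)
          = 2 * x ^+ (3 ^ N).
  by rewrite /psum big_nat_recr //= coef2; ring.
rewrite vM v2 mul1r absvalX // leNgt => /negP; apply.
apply: lt_le_trans (exprn_ege1 _ x_ge1).
by rewrite invf_lt1 ?ltr1n.
Qed.

Lemma psum_sub_head_le (R : realType) (C : fieldType) (v : C -> R) (p : nat)
    (hp : p \in [pchar C]) (hv : is_absolute_value v) (a : nat -> int) (x : C)
    (n : nat) :
  v x <= 1 -> v (psum a x n.+1 - (a 0%N)%:~R) <= v x.
Proof.
have [v_ge0 v0 vM _] := hv.
move=> vx; rewrite /psum big_nat_recl // expr0 mulr1 addrAC subrr add0r.
elim: n => [|n IHn]; first by rewrite big_geq // (v0 0).2.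
rewrite big_nat_recr //=; apply: (absval_ultrametric hp hv IHn).
rewrite vM absvalX // -[leRHS]mul1r ler_pM ?exprn_ge0 ?(absval_int_le1 hp) //.
by rewrite exprS ler_piMr // exprn_ile1.
Qed.

(** The ultrametric inequality preserves [v (S_n - 1) <= v x] in the limit. *)
Lemma B3m1_cvg_sub1_le (R : realType) (C : fieldType) (v : C -> R)
    (hchar : 3%N \in [pchar C]) (hv : is_absolute_value v) (x l : C) :
  pseries_cvg_to v B3m1 x l -> v (l - 1) <= v x.
Proof.
move=> cvg_l; have x_lt1 := B3m1_cvg_lt1 hchar hv cvg_l.
have [v_ge0 _ _ _] := hv.
rewrite leNgt; apply/negP => lt_xl.
have [|N small] := pseries_cvg_to_lt (e := v (l - 1)) hv cvg_l.
  exact: le_lt_trans lt_xl.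
have [e [lt_e leS leSl]] : exists e, [/\ e < v (l - 1),
    v (psum B3m1 x N.+1 - 1) <= e & v (psum B3m1 x N.+1 - l) <= e].
  exists (Num.max (v x) (v (psum B3m1 x N.+1 - l))).
  rewrite gt_max lt_xl small // !le_max lexx orbT; split=> //.
  by rewrite -[1]/(1%:~R) -B3m1_0 (psum_sub_head_le hchar) // ltW.
have := absval_ultrametricB hchar hv leS leSl.
have -> : psum B3m1 x N.+1 - 1 - (psum B3m1 x N.+1 - l) = l - 1 by ring.
by rewrite leNgt lt_e.
Qed.

(** * The cubic equation of the series *)

(** The relations [S = 2 x + S^3 + x^2 T^3] and [T = 1 + x T^3] become, in terms
    of [W = x^2 T^3], [W = S - S^3 - 2 x] and [x W = x^3 + W^3].  The partial
    sums satisfy them up to a change of index from [n] to [3n], and [W] is a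
    polynomial in [S] and [x], so that its convergence follows from that of [S]
    alone. *)
Lemma B3m1_cvg_elim (R : realType) (C : fieldType) (v : C -> R)
    (hchar : 3%N \in [pchar C]) (hv : is_absolute_value v) (x l : C) :
  pseries_cvg_to v B3m1 x l ->
  x * (l - l ^+ 3 - 2 * x) - x ^+ 3 - (l - l ^+ 3 - 2 * x) ^+ 3 = 0.
Proof.
move=> cvg_l; have /ltW x_le1 := B3m1_cvg_lt1 hchar hv cvg_l.
have [v_ge0 _ vM _] := hv.
apply: (absval_eq0 hv) => e e_gt0 e_le1.
have [N small] := pseries_cvg_to_lt hv cvg_l e_gt0.
pose S n := psum B3m1 x n; pose W n := S (3 * n)%N - S n ^+ 3 - 2 * x.
set Wl := l - l ^+ 3 - 2 * x.
have W_T n : (0 < n)%N -> W n = x ^+ 2 * psum bin3 x n ^+ 3.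
  by move=> n_gt0; rewrite /W /S psum_B3m1_mul3 //; ring.
have W_eq n : (0 < n)%N -> x * W (3 * n)%N = x ^+ 3 + W n ^+ 3.
  move=> n_gt0; rewrite !W_T ?psum_bin3_mul3 // ?muln_gt0 //.
  by rewrite cube_add_pchar3 //; ring.
have cube_le y : v y <= e -> v (y ^+ 3) <= e.
  move=> vy; rewrite absvalX //; apply: le_trans (vy).
  by rewrite exprS ler_piMr // exprn_ile1 // (le_trans vy).
have W_close n : (N <= n)%N -> v (W n - Wl) <= e.
  move=> leNn.
  have -> : W n - Wl = (S (3 * n)%N - l) - (S n - l) ^+ 3.
    by rewrite cube_sub_pchar3 // /W /Wl; ring.
  apply: (absval_ultrametricB hchar hv); last apply: cube_le.
    by apply/ltW/small; lia.
  exact/ltW/small.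
have -> : x * Wl - x ^+ 3 - Wl ^+ 3
          = (W N.+1 - Wl) ^+ 3 - x * (W (3 * N.+1)%N - Wl).
  by rewrite cube_sub_pchar3 // [x * (W _ - _)]mulrBr W_eq //; ring.
apply: (absval_ultrametricB hchar hv).
  by apply/cube_le/W_close; lia.
rewrite vM; have leW := W_close (3 * N.+1)%N.
by apply: le_trans (leW _); [rewrite ler_piMl | lia].
Qed.

(** Given [T = 1 + x T^3], the inverse [1 / T] is a root of the cubic and
    satisfies the same relation [S = x + x T + S^3] as [l].  The difference [d]
    of two solutions has [d^3 = d], so that the roots are those of the cubic
    translated by [0], [1] and [-1]. *)
Lemma B3m1_elim_factor (C : fieldType) (hchar : 3%N \in [pchar C]) (x l : C) :
  x * (l - l ^+ 3 - 2 * x) - x ^+ 3 - (l - l ^+ 3 - 2 * x) ^+ 3 =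
    (l ^+ 3 - l ^+ 2 + x) *
    (((l + 1) ^+ 3 - (l + 1) ^+ 2 + x) * ((l - 1) ^+ 3 - (l - 1) ^+ 2 + x)).
Proof.
rewrite !(cube_sub_pchar3 hchar) (cube_add_pchar3 hchar).
apply/eqP; rewrite -subr_eq0; apply/eqP.
(* The cofactor of 3 is the difference of both sides over the integers, once
   the cubes of sums are expanded by the Frobenius map. *)
rewrite [LHS](_ : _ = 3 *
    (2 * x ^+ 3 - l * x + l ^+ 2 * x ^+ 2 + l ^+ 3 + l ^+ 3 * x
     - l ^+ 3 * x ^+ 2 - 2 * l ^+ 4 - l ^+ 4 * x + 2 * l ^+ 5 * x + l ^+ 6
     - l ^+ 6 * x - l ^+ 7 + l ^+ 8)); last by ring.
by rewrite (nat3_eq0 hchar) mul0r.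
Qed.

(** Since [m = l - 1] satisfies [v m <= v x < 1], the factor at [l + 1] is 1
    plus something smaller than 1.  The factor at [l - 1] is [x - (m^2 - m^3)],
    where [v (m^2 - m^3) <= (v x)^2], so it only vanishes for [x = 0]; then
    [l = 1]. *)
Lemma B3m1_cvg_cubic (R : realType) (C : fieldType) (v : C -> R)
    (hchar : 3%N \in [pchar C]) (hv : is_absolute_value v) (x l : C) :
  pseries_cvg_to v B3m1 x l -> l ^+ 3 - l ^+ 2 + x = 0.
Proof.
move=> cvg_l; have x_lt1 := B3m1_cvg_lt1 hchar hv cvg_l.
have m_le := B3m1_cvg_sub1_le hchar hv cvg_l.
have [v_ge0 v0 vM _] := hv.
pose m := l - 1; have vmX k : v (m ^+ k.+1) <= v x.
  rewrite absvalX //; apply: le_trans (m_le).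
  by rewrite exprS ler_piMr // exprn_ile1 // (le_trans m_le) // ltW.
have := B3m1_cvg_elim hchar hv cvg_l.
rewrite (B3m1_elim_factor hchar) => /eqP; rewrite !mulf_eq0.
case/or3P=> /eqP // fac0.
  (* The cofactor of 3 below comes from expanding the factor at
     [l + 1 = m + 2] in powers of [m]. *)
  have E1 : 1 = m ^+ 2 - m ^+ 3 - (m + m + x).
    transitivity (m ^+ 2 - m ^+ 3 - (m + m + x)
      + ((l + 1) ^+ 3 - (l + 1) ^+ 2 + x) - 3 * (2 * m ^+ 2 + 2 * m + 1)).
      by rewrite /m; ring.
    by rewrite fac0 (nat3_eq0 hchar) mul0r addr0 subr0.
  suff : v 1 <= v x by rewrite absval1 // leNgt x_lt1.
  rewrite E1; apply: (absval_ultrametricB hchar hv).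
    by apply: (absval_ultrametricB hchar hv); apply: vmX.
  by do 2?[apply: (absval_ultrametric hchar hv)] => //; apply: (vmX 0%N).
have Ex : x = m ^+ 2 * (1 - m).
  by apply/eqP; rewrite -subr_eq0; apply/eqP; rewrite -fac0 /m; ring.
have vx_sqr : v x <= v x ^+ 2.
  rewrite {1}Ex vM absvalX // -[leRHS]mulr1.
  rewrite ler_pM ?exprn_ge0 // ?lerXn2r ?nnegrE //.
  apply: (absval_ultrametricB hchar hv); first by rewrite absval1.
  exact: le_trans m_le (ltW x_lt1).
have vx0 : v x = 0.
  by apply/eqP; rewrite eq_le v_ge0 andbT; nra.
have -> : l = 1.
  apply/eqP; rewrite -subr_eq0; apply/eqP/v0/eqP.
  by rewrite eq_le v_ge0 -vx0 m_le.
by rewrite (v0 x).1 // !expr1n subrr addr0.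
Qed.

Theorem theorem28 (R : realType) (C : fieldType) (v : C -> R)
    (hchar : 3%N \in [pchar C]) (hv : is_absolute_value v)
    (c1 c2 c3 : C) (hc1 : c1 != 0) (lambda : C) :
  let f : {poly C} := 'X^3 + c1 *: 'X^2 + c2 *: 'X + c3%:P in
  let Delta : C := c1 ^+ 2 * c2 ^+ 2 - c1 ^+ 3 * c3 - c2 ^+ 3 in
  pseries_cvg_to v B3m1 (Delta / c1 ^+ 6) lambda ->
  let alpha : C := c2 / c1 - c1 * lambda in
  f.[alpha] = 0.
Proof.
move=> f Delta /(B3m1_cvg_cubic hchar hv) cubic alpha.
rewrite /f !hornerE /= /alpha.
(* The second summand collects the multiples of 3 in the expansion over the
   integers. *)
transitivity (
  - c1 ^+ 3 * (lambda ^+ 3 - lambda ^+ 2 + Delta / c1 ^+ 6)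
    + 3 * (c2 ^+ 2 / c1 * (1 - lambda) + c1 * c2 * (lambda ^+ 2 - lambda))).
  by rewrite /Delta; field.
by rewrite cubic (nat3_eq0 hchar) mulr0 mul0r addr0.
Qed.
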